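(* The space $ces_\infty$ contains a complemented subspace isomorphic to $L_1[0,1]$.
   Context: $ces_\infty$ is the space of real sequences $a=(a_n)_{n\ge1}$ with $\|a\|=\sup_{n\ge1}\frac1n\sum_{k=1}^n|a_k|<\infty$. *)

(* Defs.v *)
From HB Require Import structures.
From mathcomp Require Import all_boot all_order all_algebra.
From mathcomp Require Import all_classical all_reals all_analysis.
Set Implicit Arguments. Unset Strict Implicit. Unset Printing Implicit Defensive.
Import Order.TTheory GRing.Theory Num.Theory.
Import numFieldNormedType.Exports.
Local Open Scope classical_set_scope.
Local Open Scope ring_scope.

Section Defs.
Variable R : realType.

(* Sequences a = (a_n)_{n>=1} are represented by a : nat -> R with a k = a_{k+1}. *)
Definition ces_avg (a : nat -> R) (m : nat) : R :=
  (m.+1%:R)^-1 * \sum_(k < m.+1) `|a k|.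

Definition in_ces_inf (a : nat -> R) : Prop :=
  exists M : R, forall m, ces_avg a m <= M.

Definition ces_norm (a : nat -> R) : R := sup (range (ces_avg a)).

Definition in_L1_01 (f : R -> R) : Prop :=
  (@lebesgue_measure R).-integrable `[0%R, 1%R] (EFin \o f).

Definition L1_norm (f : R -> R) : R :=
  fine (\int[@lebesgue_measure R]_(x in `[0%R, 1%R]) (`|f x|)%:E)%E.

End Defs.

(* Main.v *)
(** Up to equivalence of norms, [ces_inf] is the l_oo-sum of the spaces
    l_1^{2^n}: the n-th block consists of the indices k with k + 1 in
    [2^n, 2^(n+1)[, and its entries are read as the values of a step function
    on the 2^n dyadic intervals of length 2^-n.  The embedding T sends f to the
    sequence of all its averages over dyadic intervals; Lebesgue's
    differentiation theorem and Fatou's lemma bound the norm of f by that of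
    T f.

    For the projection, let g_n >= 0 be the step functions of a nonnegative
    sequence a, which are bounded in L_1.  Along an ultrafilter the masses
    int_A min(g_n, K) have a limit; its supremum over K is, as a function of A,
    a finite measure that is absolutely continuous (truncation makes the family
    equi-integrable) and additive in a, since
      min(a + b, K) <= min(a, K) + min(b, K) <= min(a + b, 2K).
    By Radon-Nikodym it has a density in L_1, and P a is T of that density,
    extended to signed a by a = a^+ - a^-.  If a = T f with f >= 0, Jensen's
    inequality on dyadic intervals gives int_I min(f, K) <= int_I min(g_n, K)
    <= int_I f, hence the density is f and P is a projection onto the range
    of T. *)
Require Import Defs.
From HB Require Import structures.
From mathcomp Require Import all_boot all_order all_algebra.
From mathcomp Require Import all_classical all_reals all_analysis.
From mathcomp Require Import measurable_realfun.
From mathcomp Require Import zify ring lra.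
Import Order.TTheory GRing.Theory Num.Theory.
Import numFieldNormedType.Exports.
Local Open Scope classical_set_scope.
Local Open Scope ring_scope.

(** * Dyadic indexing of sequences *)

(* Entry j of block n is a_(2^n + j); sequences are stored with a k = a_(k+1). *)
Definition cell_index (n j : nat) : nat := (2 ^ n + j).-1.
Definition cell_level (k : nat) : nat := trunc_log 2 k.+1.
Definition cell_pos (k : nat) : nat := (k.+1 - 2 ^ cell_level k)%N.

Lemma cell_indexS n j : (cell_index n j).+1 = (2 ^ n + j)%N.
Proof. by rewrite /cell_index prednK// addn_gt0 expn_gt0. Qed.

Lemma cell_level_index n j : (j < 2 ^ n)%N -> cell_level (cell_index n j) = n.
Proof.
move=> jn; rewrite /cell_level cell_indexS; apply: trunc_log_eq => //.
by rewrite leq_addr/= expnS mul2n -addnn ltn_add2l.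
Qed.

Lemma cell_pos_index n j : (j < 2 ^ n)%N -> cell_pos (cell_index n j) = j.
Proof.
by move=> jn; rewrite /cell_pos cell_level_index// cell_indexS addKn.
Qed.

Lemma cell_level_bounds k :
  (2 ^ cell_level k <= k.+1 < 2 ^ (cell_level k).+1)%N.
Proof. exact: trunc_log_bounds. Qed.

Lemma cell_pos_lt k : (cell_pos k < 2 ^ cell_level k)%N.
Proof.
have /andP[h1 h2] := cell_level_bounds k.
by rewrite /cell_pos ltn_subLR// addnn -mul2n -expnS.
Qed.

(** * The Cesàro norm and the normalised l_1 norms of the dyadic blocks *)

Section BlockNorm.
Variable R : realType.
Implicit Types a : nat -> R.

Definition block_sum a n : R := \sum_(j < 2 ^ n) `|a (cell_index n j)|.

(** The first N blocks exhaust the stored indices below 2^N - 1, because k + 1 then runs through [1,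
    2^N[. *)
Lemma sum_blocks a N :
  \sum_(k < (2 ^ N).-1) `|a k| = \sum_(n < N) block_sum a n.
Proof.
elim: N => [|N IH]; first by rewrite !big_ord0.
rewrite big_ord_recr/= -IH -!(big_mkord xpredT (fun k => `|a k|)).
have p0 : (0 < 2 ^ N)%N by rewrite expn_gt0.
rewrite (@big_cat_nat _ _ _ (2 ^ N).-1)//=; last by rewrite expnS; lia.
(* The remaining range [2^N - 1, 2^(N+1) - 1[ is shifted down by 2^N - 1 to become block N. *)
congr (_ + _); rewrite -{1}[(2 ^ N).-1]addn0 addnC.
rewrite -(_ : (2 ^ N + (2 ^ N).-1)%N = (2 ^ N.+1).-1); last first.
  by rewrite expnS; lia.
rewrite big_addn addnK big_mkord; apply: eq_bigr => j _.
by congr (`|a _|); rewrite /cell_index; lia.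
Qed.

Lemma ces_sum_le a M m : (forall m, ces_avg a m <= M) ->
  \sum_(k < m) `|a k| <= m%:R * M.
Proof.
move=> h; case: m => [|m]; first by rewrite big_ord0 mul0r.
by have := h m; rewrite /ces_avg ler_pdivrMl.
Qed.

Lemma ces_bound_ge0 a M : (forall m, ces_avg a m <= M) -> 0 <= M.
Proof.
move=> h; apply: le_trans (h 0%N); rewrite /ces_avg mulr_ge0//.
by rewrite sumr_ge0.
Qed.

(** Block n lies among the first 2^(n+1) - 1 entries, whose sum is at most (2^(n+1) - 1) M; this is
    where the factor 2 arises. *)
Lemma block_sum_le a M n : (forall m, ces_avg a m <= M) ->
  block_sum a n <= 2 ^+ n * (2 * M).
Proof.
move=> h; have M0 := ces_bound_ge0 _ _ h.
apply: (@le_trans _ _ (\sum_(i < n.+1) block_sum a i)).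
  by rewrite big_ord_recr/= lerDr sumr_ge0// => i _; rewrite sumr_ge0.
rewrite -sum_blocks (le_trans (ces_sum_le _ _ _ h))// mulrA -exprSr.
by rewrite ler_wpM2r// -natrX ler_nat leq_pred.
Qed.

(** Completing the initial segment to whole blocks, up to the level n of m, costs a geometric sum
    below 2^(n+1), and 2^n <= m + 1. *)
Lemma ces_avg_le a M m : (forall n, block_sum a n <= 2 ^+ n * M) ->
  ces_avg a m <= 2 * M.
Proof.
move=> h; have M0 : 0 <= M.
  by have := h 0%N; rewrite mul1r; apply: le_trans; rewrite sumr_ge0.
rewrite /ces_avg ler_pdivrMl//.
have /andP[h1 h2] := cell_level_bounds m; set n := cell_level m in h1 h2.
apply: (@le_trans _ _ (\sum_(k < (2 ^ n.+1).-1) `|a k|)).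
  rewrite -!(big_mkord xpredT (fun k => `|a k|)).
  rewrite [leRHS](@big_cat_nat _ _ _ m.+1)//=; last by lia.
  by rewrite lerDl sumr_ge0.
rewrite sum_blocks; apply: (@le_trans _ _ (\sum_(i < n.+1) 2 ^+ i * M)).
  by apply: ler_sum => i _; exact: h.
rewrite -mulr_suml (_ : \sum_(i < n.+1) 2 ^+ i = 2 ^+ n.+1 - 1); last first.
  elim: {h1 h2}n.+1 => [|k IH]; first by rewrite big_ord0 subrr.
  by rewrite big_ord_recr/= IH exprS; ring.
rewrite mulrA ler_wpM2r// lerBlDr (le_trans (y := m.+1%:R * 2))//; last first.
  by rewrite lerDl.
by rewrite exprSr ler_wpM2r// -natrX ler_nat.
Qed.

Lemma in_ces_infP a :
  in_ces_inf a <-> exists M, forall n, block_sum a n <= 2 ^+ n * M.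
Proof.
split=> -[M h]; first by exists (2 * M) => n; exact: block_sum_le.
by exists (2 * M) => m; exact: ces_avg_le.
Qed.

Lemma ces_avg_le_norm a m : in_ces_inf a -> ces_avg a m <= ces_norm a.
Proof.
move=> [M h]; rewrite /ces_norm; apply: ub_le_sup; last by exists m.
by exists M => _ [k _ <-].
Qed.

Lemma ces_norm_le a M : (forall m, ces_avg a m <= M) -> ces_norm a <= M.
Proof.
move=> h; rewrite /ces_norm; apply: ge_sup; first by exists (ces_avg a 0), 0%N.
by move=> _ [k _ <-].
Qed.

End BlockNorm.

(** * Limits of bounded sequences along a free ultrafilter *)

Definition ultra_nat : set_system nat :=
  sval (cid (ultraFilterLemma (F := \oo) _)).

#[local] Instance ultra_nat_ultra : UltraFilter ultra_nat.
Proof. by rewrite /ultra_nat; case: cid => U []. Qed.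

#[local] Instance ultra_nat_proper : ProperFilter ultra_nat.
Proof. exact: ultra_proper. Qed.

Lemma ultra_nat_ge N : ultra_nat [set n | (N <= n)%N].
Proof.
rewrite /ultra_nat; case: cid => U [_ subU] /=.
by apply: subU; exists N.
Qed.

Lemma ultra_fmap (T S : Type) (f : T -> S) (F : set_system T) :
  UltraFilter F -> UltraFilter (f @ F).
Proof.
move=> FU; have FF := ultra_proper; split=> [|G GF FG].
  exact: fmap_proper_filter.
apply/seteqP; split=> // B GB; rewrite /fmap/=.
have [//|nB] := in_ultra_setVsetC (f @^-1` B) FU.
have GnB : G (~` B) by exact: FG.
have /filter_not_empty[] : G set0 by rewrite -(setICr B); exact: filterI.
Qed.

Section UltraLimit.
Variable R : realType.
Implicit Types (u v : nat -> R) (M N : R).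

Definition ulim u : R := lim (u @ ultra_nat).

(** The image ultrafilter contains the compact segment [-M, M], hence converges. *)
Lemma cvg_ulim u M : (forall n, `|u n| <= M) -> u @ ultra_nat --> ulim u.
Proof.
move=> uM; have := @segment_compact R (- M) M; rewrite compact_ultra.
move=> /(_ (u @ ultra_nat) (ultra_fmap _ _ _ _ _)) [|p [_ up]].
  apply: (@filterE _ ultra_nat) => n /=; rewrite in_itv/=.
  by have := uM n; rewrite ler_norml.
by apply/cvg_ex; exists p.
Qed.

Lemma ulim_unique u l : u @ ultra_nat --> l -> ulim u = l.
Proof. by move=> ul; exact: cvg_lim. Qed.

Lemma ulimD u v M N : (forall n, `|u n| <= M) -> (forall n, `|v n| <= N) ->
  ulim (fun n => u n + v n) = ulim u + ulim v.
Proof.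
move=> uM vN; apply: ulim_unique.
by apply: cvgD; [exact: cvg_ulim uM|exact: cvg_ulim vN].
Qed.

Lemma ulimZ u M c : (forall n, `|u n| <= M) ->
  ulim (fun n => c * u n) = c * ulim u.
Proof.
move=> uM; apply: ulim_unique.
by apply: cvgM; [exact: cvg_cst|exact: cvg_ulim uM].
Qed.

(** The ultrafilter contains every tail. The rank k matters for a cell of level m, where the
    estimates start at n = m. *)
Lemma ler_ulim u v M N k : (forall n, `|u n| <= M) -> (forall n, `|v n| <= N) ->
  (forall n, (k <= n)%N -> u n <= v n) -> ulim u <= ulim v.
Proof.
move=> uM vN uv; apply: (ler_cvg_to (cvg_ulim _ _ uM) (cvg_ulim _ _ vN)).
by apply: filterS (ultra_nat_ge k) => n; exact: uv.
Qed.

Lemma ulim_cst c : ulim (fun=> c) = c.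
Proof. by apply: ulim_unique; exact: cvg_cst. Qed.

End UltraLimit.

(** * Dyadic intervals and their measure *)

Section DyadicCells.
Variable R : realType.
Local Notation mu := (@lebesgue_measure R).
Local Notation I01 := (`[(0:R), 1[%classic : set R).

Implicit Types (A B : set R) (f : R -> R) (m n i j : nat) (x : R).

(** Half-open, so that the cells of one level partition [[0, 1[] exactly; the lost endpoint 1 is a
    null set. *)
Definition cell (n j : nat) : set R := `[j%:R / 2 ^+ n, j.+1%:R / 2 ^+ n[.

Definition leb (A : set R) : R := fine (mu A).

Lemma exp2_gt0 n : 0 < 2 ^+ n :> R.
Proof. exact: exprn_gt0. Qed.

Lemma cellE n j x : cell n j x <-> j%:R <= x * 2 ^+ n < j.+1%:R.
Proof.
rewrite /cell/= in_itv/= ler_pdivrMr ?exp2_gt0//.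
by rewrite ltr_pdivlMr ?exp2_gt0.
Qed.

Lemma cell_inj n i j x : cell n i x -> cell n j x -> i = j.
Proof.
move=> /cellE/andP[i1 i2] /cellE/andP[j1 j2]; apply/eqP; rewrite eqn_leq.
rewrite -[(i <= j)%N]ltnS -[(j <= i)%N]ltnS -!(ltr_nat R).
by rewrite (le_lt_trans i1 j2) (le_lt_trans j1 i2).
Qed.

Lemma measurable_cell n j : measurable (cell n j).
Proof. exact: measurable_itv. Qed.

Lemma lebesgue_measure_cell n j : mu (cell n j) = ((2 ^+ n)^-1)%:E.
Proof.
rewrite /cell lebesgue_measure_itv/= lte_fin ltr_pM2r ?invr_gt0 ?exp2_gt0//.
by rewrite ltr_nat ltnSn -EFinB -mulrBl -natrB// subSnn mul1r.
Qed.

Lemma bigcup_cells n q :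
  \big[setU/set0]_(j < q) cell n j = `[0%R, q%:R / 2 ^+ n[%classic.
Proof.
elim: q => [|q IH]; first by rewrite big_ord0 mul0r set_itvco0.
rewrite big_ord_recr/= IH /cell; apply/seteqP; split=> x /=; rewrite !in_itv/=.
- case=> /andP[h1 h2].
    by rewrite h1 (lt_le_trans h2)// ler_pM2r ?invr_gt0 ?exp2_gt0// ler_nat.
  by rewrite h2 (le_trans _ h1)// mulr_ge0// invr_ge0 ltW// exp2_gt0.
- move=> /andP[h1 h2]; case: (ltP x (q%:R / 2 ^+ n)) => h.
    by left; rewrite h1.
  by right; rewrite h2.
Qed.

Lemma bigcup_cells01 n : \big[setU/set0]_(j < 2 ^ n) cell n j = I01.
Proof. by rewrite bigcup_cells natrX divff// gt_eqF// exp2_gt0. Qed.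

Lemma cell_sub01 n j : (j < 2 ^ n)%N -> cell n j `<=` I01.
Proof.
move=> jn x xj; rewrite -(bigcup_cells01 n) -bigcup_mkord; by exists j.
Qed.

(** The only cell of level m that meets [cell n j] is its ancestor, of position j %/ 2^(n - m). *)
Lemma cell_nested m n i j : (m <= n)%N ->
  cell n j `<=` cell m i \/ cell m i `&` cell n j = set0.
Proof.
move=> /subnKC <-; set d := (n - m)%N.
have [ij|ij] := eqVneq (j %/ 2 ^ d)%N i.
- left=> x /cellE/andP[h1 h2]; apply/cellE.
  rewrite exprD mulrA in h1 h2; set y := x * 2 ^+ m in h1 h2 *.
  have d0 : (0 < 2 ^ d)%N by rewrite expn_gt0.
  have e : 2 ^+ d = (2 ^ d)%:R :> R by rewrite natrX.
  apply/andP; split.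
    rewrite -(ler_pM2r (exp2_gt0 d)) (le_trans _ h1)// e -natrM ler_nat -ij.
    exact: leq_trunc_div.
  rewrite -(ltr_pM2r (exp2_gt0 d)) (lt_le_trans h2)// e -natrM ler_nat -ij.
  by rewrite ltn_ceil.
- right; apply/eqP; apply: contraNT ij => /set0P[x [/cellE/andP[i1 i2]]].
  move=> /cellE; rewrite exprD mulrA; set y := x * 2 ^+ m in i1 i2 *.
  move=> /andP[j1 j2].
  have d0 : (0 < 2 ^ d)%N by rewrite expn_gt0.
  have e : 2 ^+ d = (2 ^ d)%:R :> R by rewrite natrX.
  rewrite -(ler_pM2r (exp2_gt0 d)) e -natrM in i1.
  rewrite -(ltr_pM2r (exp2_gt0 d)) e -natrM in i2.
  rewrite e in j1 j2.
  have := le_lt_trans i1 j2; have := le_lt_trans j1 i2; rewrite !ltr_nat.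
  move=> a1 a2; rewrite eqn_leq -ltnS ltn_divLR// a1/=.
  by rewrite leq_divRL.
Qed.

Lemma integrable_sub01 f A : in_L1_01 f -> measurable A -> A `<=` I01 ->
  mu.-integrable A (EFin \o f).
Proof.
move=> intf mA A01; apply: integrableS intf => //.
move=> x /A01; rewrite /= !in_itv/= => /andP[-> /ltW ->//].
Qed.

Lemma Rintegral_cells f A n : measurable A ->
  mu.-integrable (A `&` I01) (EFin \o f) ->
  \sum_(j < 2 ^ n) \int[mu]_(x in A `&` cell n j) f x =
  \int[mu]_(x in A `&` I01) f x.
Proof.
move=> mA intf; rewrite -(bigcup_cells01 n).
suff h q : (q <= 2 ^ n)%N ->
    \sum_(j < q) \int[mu]_(x in A `&` cell n j) f x =
    \int[mu]_(x in A `&` \big[setU/set0]_(j < q) cell n j) f x by exact: h.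
elim: q => [|q IH] qn.
  by rewrite !big_ord0 setI0 Rintegral_set0.
rewrite !big_ord_recr/= IH; last exact: ltnW.
have mq : measurable (\big[setU/set0]_(j < q) cell n j).
  by apply: bigsetU_measurable => j _; exact: measurable_cell.
rewrite setIUr Rintegral_setU//.
- exact: measurableI.
- by apply: measurableI => //; exact: measurable_cell.
- apply: integrableS intf => //.
  + by apply: measurableI => //; exact: measurable_itv.
  + by apply: measurableU; apply: measurableI => //; exact: measurable_cell.
  + rewrite -setIUr; apply: setIS.
    rewrite -(bigcup_cells01 n).
    rewrite -[X in X `<=` _](@big_ord_recr _ _ _ _ (cell n)).
    rewrite -!bigcup_mkord => x [j /= jq xj]; exists j => //=.
    exact: leq_trans jq qn.
- apply/disj_setPS => x [[_ xq] [_ xc]].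
  move: xq; rewrite -bigcup_mkord => -[j /= jq xj].
  by move: jq; rewrite (cell_inj _ _ _ _ xj xc) ltnn.
Qed.

Lemma lebI01_lty A : measurable A -> (mu (A `&` I01) < +oo)%E.
Proof.
move=> mA; apply: (@le_lt_trans _ _ (mu I01)).
  apply: le_measure; rewrite ?inE; last exact: subIsetr.
    exact: measurableI.
  exact: measurable_itv.
by rewrite lebesgue_measure_itv/= lte_fin ltr01 ltry.
Qed.

Lemma leb_ge0 A : 0 <= leb A.
Proof. by rewrite fine_ge0. Qed.

(** This is [Rintegral_cells] for the constant function 1. *)
Lemma leb_cells A n : measurable A ->
  \sum_(j < 2 ^ n) leb (A `&` cell n j) = leb (A `&` I01).
Proof.
move=> mA.
have mA1 : measurable (A `&` I01).
  by apply: measurableI => //; exact: measurable_itv.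
have := @Rintegral_cells (cst 1) A n mA.
rewrite Rintegral_cst// mul1r /leb => <-.
  apply: eq_bigr => j _; rewrite Rintegral_cst ?mul1r//.
  by apply: measurableI => //; exact: measurable_cell.
apply: measurable_bounded_integrable => //; first exact: lebI01_lty.
exact: bounded_cst.
Qed.

Lemma leb_cell_lty A n j : measurable A -> (mu (A `&` cell n j) < +oo)%E.
Proof.
move=> mA; have mc := measurable_cell n j.
apply: (@le_lt_trans _ _ (mu (cell n j))).
  apply: le_measure; rewrite ?inE; last exact: subIsetr.
    exact: measurableI.
  exact: mc.
by rewrite lebesgue_measure_cell ltry.
Qed.

Lemma leb_cell_le A n j : measurable A -> leb (A `&` cell n j) <= (2 ^+ n)^-1.
Proof.
move=> mA; have mc := measurable_cell n j.
rewrite /leb -lee_fin fineK; last by rewrite ge0_fin_numE// leb_cell_lty.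
rewrite -(lebesgue_measure_cell n j).
apply: le_measure; rewrite ?inE; last exact: subIsetr.
  exact: measurableI.
exact: mc.
Qed.

Lemma leb_cellU A B n j : measurable A -> measurable B -> A `&` B = set0 ->
  leb ((A `|` B) `&` cell n j) = leb (A `&` cell n j) + leb (B `&` cell n j).
Proof.
move=> mA mB AB; have mc := measurable_cell n j.
rewrite /leb setIUl measureU ?fineD ?ge0_fin_numE ?leb_cell_lty//.
- exact: measurableI.
- exact: measurableI.
- by rewrite setIACA AB set0I.
Qed.

End DyadicCells.

(** * The mass that survives truncation, as a finitely additive set function *)

Section AbsolutelyContinuousPart.
Variable R : realType.
Local Notation mu := (@lebesgue_measure R).
Local Notation I01 := (`[(0:R), 1[%classic : set R).
Implicit Types (a b : nat -> R) (A B : set R) (M c : R).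

Definition nonneg a := forall k, 0 <= a k.
Definition block_bounded a M := forall n, block_sum _ a n <= 2 ^+ n * M.

(* The integral over [A] of [min g_n K], where [g_n] is the step function
   taking the value [a (cell_index n j)] on [cell n j]. *)
Definition trunc_mass a K n A : R :=
  \sum_(j < 2 ^ n) Num.min (a (cell_index n j)) K * leb R (A `&` cell R n j).

Lemma trunc_mass_ge0 a K n A : nonneg a -> 0 <= K -> 0 <= trunc_mass a K n A.
Proof.
move=> a0 K0; apply: sumr_ge0 => j _; rewrite mulr_ge0 ?leb_ge0//.
by rewrite le_min a0 K0.
Qed.

(** Since min(a, K) <= a and a cell has measure 2^-n, the mass is at most the normalised block
    sum. *)
Lemma trunc_mass_le a K n A M : nonneg a -> block_bounded a M ->
  measurable A -> trunc_mass a K n A <= M.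
Proof.
move=> a0 aM mA; rewrite -(ler_pM2l (exp2_gt0 R n)) (le_trans _ (aM n))//.
rewrite mulr_sumr; apply: ler_sum => j _.
rewrite ger0_norm// mulrCA -[leRHS]mulr1.
apply: (@le_trans _ _
    (a (cell_index n j) * (2 ^+ n * leb R (A `&` cell R n j)))).
  by rewrite ler_wpM2r ?ge_min ?lexx// mulr_ge0 ?leb_ge0// ltW// exp2_gt0.
rewrite ler_wpM2l// -ler_pdivlMl ?exp2_gt0// mulr1.
exact: leb_cell_le.
Qed.

Lemma normr_trunc_mass_le a K n A M : nonneg a -> block_bounded a M ->
  0 <= K -> measurable A -> `|trunc_mass a K n A| <= M.
Proof.
by move=> a0 aM K0 mA; rewrite ger0_norm ?trunc_mass_ge0// trunc_mass_le.
Qed.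

(** The truncated density is at most K, uniformly in n: the source of absolute continuity. *)
Lemma trunc_mass_leb a K n A : measurable A ->
  trunc_mass a K n A <= K * leb R (A `&` I01).
Proof.
move=> mA; rewrite -(leb_cells _ A n)// mulr_sumr; apply: ler_sum => j _.
by rewrite ler_wpM2r ?leb_ge0// ge_min lexx orbT.
Qed.

Lemma ler_trunc_mass a K L n A : K <= L ->
  trunc_mass a K n A <= trunc_mass a L n A.
Proof.
move=> KL; apply: ler_sum => j _; rewrite ler_wpM2r ?leb_ge0//.
by rewrite le_min ge_min lexx/= ge_min KL orbT.
Qed.

Lemma trunc_massU a K n A B : measurable A -> measurable B ->
  A `&` B = set0 ->
  trunc_mass a K n (A `|` B) = trunc_mass a K n A + trunc_mass a K n B.
Proof.
move=> mA mB AB; rewrite /trunc_mass -big_split/=; apply: eq_bigr => j _.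
by rewrite leb_cellU// mulrDr.
Qed.

Lemma trunc_massD_le a b K n A : nonneg a -> nonneg b -> 0 <= K ->
  trunc_mass (fun k => a k + b k) K n A <=
  trunc_mass a K n A + trunc_mass b K n A.
Proof.
move=> a0 b0 K0; rewrite -big_split/=; apply: ler_sum => j _.
rewrite -mulrDl ler_wpM2r ?leb_ge0//.
have := a0 (cell_index n j); have := b0 (cell_index n j).
by rewrite !minEle; do 3 case: ifPn => //; rewrite -?ltNge; lra.
Qed.

Lemma trunc_massD_ge a b K n A : nonneg a -> nonneg b -> 0 <= K ->
  trunc_mass a K n A + trunc_mass b K n A <=
  trunc_mass (fun k => a k + b k) (K + K) n A.
Proof.
move=> a0 b0 K0; rewrite -big_split/=; apply: ler_sum => j _.
rewrite -mulrDl ler_wpM2r ?leb_ge0//.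
by rewrite le_min !lerD// ge_min lexx ?orbT.
Qed.

Lemma trunc_massZ_le a c K L n A : 0 <= c -> K <= c * L ->
  trunc_mass (fun k => c * a k) K n A <= c * trunc_mass a L n A.
Proof.
move=> c0 KL; rewrite mulr_sumr; apply: ler_sum => j _.
rewrite mulrA ler_wpM2r ?leb_ge0// minr_pMr//.
by rewrite le_min ge_min lexx/= ge_min KL orbT.
Qed.

Definition trunc_ac a (K : nat) A : R :=
  ulim R (fun n => trunc_mass a K%:R n A).

(** By monotonicity in K the limit is a supremum. It is the mass on A of the biting limit of the
    step functions g_n along the ultrafilter. *)
Definition ac_mass a A : R := limn (fun K => trunc_ac a K A).

Lemma trunc_ac_le a K A M : nonneg a -> block_bounded a M -> measurable A ->
  trunc_ac a K A <= M.
Proof.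
move=> a0 aM mA; rewrite -(ulim_cst R M).
apply: (@ler_ulim _ _ _ M `|M| 0%N) => n; first exact: normr_trunc_mass_le.
  by [].
by move=> _; exact: trunc_mass_le.
Qed.

Lemma trunc_ac_ge0 a K A M : nonneg a -> block_bounded a M -> measurable A ->
  0 <= trunc_ac a K A.
Proof.
move=> a0 aM mA; rewrite -(ulim_cst R 0).
apply: (@ler_ulim _ _ _ 0 M 0%N) => n; first by rewrite normr0.
  exact: normr_trunc_mass_le.
by move=> _; exact: trunc_mass_ge0.
Qed.

Lemma trunc_ac_leb a K A M : nonneg a -> block_bounded a M -> measurable A ->
  trunc_ac a K A <= K%:R * leb R (A `&` I01).
Proof.
move=> a0 aM mA; rewrite -(ulim_cst R (K%:R * _)).
apply: (@ler_ulim _ _ _ M `|K%:R * leb R (A `&` I01)| 0%N) => n.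
- exact: normr_trunc_mass_le.
- by [].
- by move=> _; exact: trunc_mass_leb.
Qed.

Lemma nondecreasing_trunc_ac a A M : nonneg a -> block_bounded a M ->
  measurable A -> nondecreasing_seq (fun K => trunc_ac a K A).
Proof.
move=> a0 aM mA K L KL.
apply: (@ler_ulim _ _ _ M M 0%N) => n.
- exact: normr_trunc_mass_le.
- exact: normr_trunc_mass_le.
- by move=> _; apply: ler_trunc_mass; rewrite ler_nat.
Qed.

Lemma trunc_acU a K A B M : nonneg a -> block_bounded a M ->
  measurable A -> measurable B -> A `&` B = set0 ->
  trunc_ac a K (A `|` B) = trunc_ac a K A + trunc_ac a K B.
Proof.
move=> a0 aM mA mB AB; rewrite /trunc_ac -(@ulimD _ _ _ M M).
- by congr ulim; apply/funext => n; exact: trunc_massU.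
- by move=> n; exact: normr_trunc_mass_le.
- by move=> n; exact: normr_trunc_mass_le.
Qed.

Lemma cvg_trunc_ac a A M : nonneg a -> block_bounded a M -> measurable A ->
  (fun K => trunc_ac a K A) @ \oo --> ac_mass a A.
Proof.
move=> a0 aM mA; apply: nondecreasing_is_cvgn.
  exact: nondecreasing_trunc_ac aM _.
by exists M => _ [K _ <-]; exact: trunc_ac_le.
Qed.

Lemma trunc_ac_le_ac a K A M : nonneg a -> block_bounded a M -> measurable A ->
  trunc_ac a K A <= ac_mass a A.
Proof.
move=> a0 aM mA.
apply: (nondecreasing_cvgn_le (nondecreasing_trunc_ac _ _ _ a0 aM mA)).
exact: (cvgP _ (cvg_trunc_ac _ _ _ a0 aM mA)).
Qed.

Lemma ac_mass_le a A M l : nonneg a -> block_bounded a M -> measurable A ->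
  (forall K, trunc_ac a K A <= l) -> ac_mass a A <= l.
Proof.
move=> a0 aM mA h; apply: limr_le; last by apply: nearW.
exact: (cvgP _ (cvg_trunc_ac _ _ _ a0 aM mA)).
Qed.

Lemma ac_mass_ge0 a A M : nonneg a -> block_bounded a M -> measurable A ->
  0 <= ac_mass a A.
Proof.
move=> a0 aM mA; apply: le_trans (trunc_ac_le_ac _ 0 _ _ a0 aM mA).
exact: trunc_ac_ge0 aM _.
Qed.

Lemma ac_mass_le_bound a A M : nonneg a -> block_bounded a M -> measurable A ->
  ac_mass a A <= M.
Proof.
move=> a0 aM mA; apply: (ac_mass_le _ _ _ _ a0 aM mA) => K.
exact: trunc_ac_le.
Qed.

Lemma ac_massU a A B M : nonneg a -> block_bounded a M ->
  measurable A -> measurable B -> A `&` B = set0 ->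
  ac_mass a (A `|` B) = ac_mass a A + ac_mass a B.
Proof.
move=> a0 aM mA mB AB; apply: cvg_lim => //.
under eq_fun do rewrite (trunc_acU _ _ _ _ _ a0 aM mA mB AB).
by apply: cvgD; exact: cvg_trunc_ac aM _.
Qed.

Lemma block_boundedD a b M N : block_bounded a M -> block_bounded b N ->
  block_bounded (fun k => a k + b k) (M + N).
Proof.
move=> aM bN n; rewrite mulrDr (le_trans _ (lerD (aM n) (bN n)))//.
by rewrite -big_split/=; apply: ler_sum => j _; exact: ler_normD.
Qed.

Lemma block_boundedZ a c M : block_bounded a M ->
  block_bounded (fun k => c * a k) (`|c| * M).
Proof.
move=> aM n; rewrite mulrCA (le_trans _ (ler_wpM2l _ (aM n)))//.
by rewrite mulr_sumr; apply: ler_sum => j _; rewrite normrM.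
Qed.

Lemma ac_massD a b A M N : nonneg a -> nonneg b ->
  block_bounded a M -> block_bounded b N -> measurable A ->
  ac_mass (fun k => a k + b k) A = ac_mass a A + ac_mass b A.
Proof.
move=> a0 b0 aM bN mA.
have ab0 : nonneg (fun k => a k + b k) by move=> k; rewrite addr_ge0.
have abMN := block_boundedD _ _ _ _ aM bN.
apply/eqP; rewrite eq_le; apply/andP; split.
  apply: (ac_mass_le _ _ _ _ ab0 abMN mA) => K.
  apply: (@le_trans _ _ (trunc_ac a K A + trunc_ac b K A)); last first.
    by apply: lerD; [exact: trunc_ac_le_ac aM _|exact: trunc_ac_le_ac bN _].
  rewrite /trunc_ac -(@ulimD _ _ _ M N).
  - apply: (@ler_ulim _ _ _ (M + N) (M + N) 0%N) => n.
    + exact: normr_trunc_mass_le.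
    + by rewrite (le_trans (ler_normD _ _))// lerD// normr_trunc_mass_le.
    + by move=> _; exact: trunc_massD_le.
  - by move=> n; exact: normr_trunc_mass_le.
  - by move=> n; exact: normr_trunc_mass_le.
(* For the other inequality, the truncation of the sum at level K + K dominates the two truncations
   at level K; the limit in K absorbs the doubling. *)
have h : (fun K => trunc_ac a K A + trunc_ac b K A) @ \oo -->
    ac_mass a A + ac_mass b A.
  by apply: cvgD; [exact: cvg_trunc_ac aM _|exact: cvg_trunc_ac bN _].
rewrite -(cvg_lim _ h)//; apply: limr_le; first exact: (cvgP _ h).
apply: nearW => K; apply: le_trans (trunc_ac_le_ac _ (K + K)%N _ _ ab0 abMN mA).
rewrite /trunc_ac -(@ulimD _ _ _ M N).
- apply: (@ler_ulim _ _ _ (M + N) (M + N) 0%N) => n.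
  + by rewrite (le_trans (ler_normD _ _))// lerD// normr_trunc_mass_le.
  + exact: normr_trunc_mass_le.
  + by move=> _; rewrite natrD; exact: trunc_massD_ge.
- by move=> n; exact: normr_trunc_mass_le.
- by move=> n; exact: normr_trunc_mass_le.
Qed.

Lemma ac_massZ_le a c A M : nonneg a -> block_bounded a M -> measurable A ->
  0 < c -> ac_mass (fun k => c * a k) A <= c * ac_mass a A.
Proof.
move=> a0 aM mA c0.
have ca0 : nonneg (fun k => c * a k) by move=> k; rewrite mulr_ge0// ltW.
have caM := block_boundedZ _ c _ aM.
apply: (ac_mass_le _ _ _ _ ca0 caM mA) => K.
(* A natural level L with K <= c L, so that min(c a, K) <= c min(a, L). *)
pose L := (Num.truncn (K%:R / c)).+1.
have KL : K%:R <= c * L%:R.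
  by rewrite -ler_pdivrMl// mulrC ltW// truncnS_gt.
apply: (@le_trans _ _ (c * trunc_ac a L A)); last first.
  by rewrite ler_pM2l//; exact: trunc_ac_le_ac aM _.
rewrite /trunc_ac -(@ulimZ _ _ M).
  apply: (@ler_ulim _ _ _ (`|c| * M) (`|c| * M) 0%N) => n.
  + exact: normr_trunc_mass_le.
  + by rewrite normrM ler_wpM2l// normr_trunc_mass_le.
  + by move=> _; apply: trunc_massZ_le => //; exact: ltW.
by move=> n; exact: normr_trunc_mass_le.
Qed.

(** The reverse inequality is [ac_massZ_le] for the sequence c a and the factor 1/c. *)
Lemma ac_massZ a c A M : nonneg a -> block_bounded a M -> measurable A ->
  0 < c -> ac_mass (fun k => c * a k) A = c * ac_mass a A.
Proof.
move=> a0 aM mA c0; apply/eqP; rewrite eq_le (ac_massZ_le _ _ _ _ a0 aM)//=.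
have ca0 : nonneg (fun k => c * a k) by move=> k; rewrite mulr_ge0// ltW.
have caM := block_boundedZ _ c _ aM.
rewrite -ler_pdivlMl//; apply: le_trans (ac_massZ_le _ _ _ _ ca0 caM mA _).
  rewrite (_ : (fun k => _) = a)//; apply/funext => k.
  by rewrite mulKf// gt_eqF.
by rewrite invr_gt0.
Qed.

Lemma ac_mass_set0 a M : nonneg a -> block_bounded a M -> ac_mass a set0 = 0.
Proof.
move=> a0 aM.
have := ac_massU _ set0 set0 _ a0 aM measurable0 measurable0 (setI0 _).
rewrite setU0; lra.
Qed.

Lemma ac_mass_bigsetU a M (F : (set R)^nat) n : nonneg a -> block_bounded a M ->
  (forall i, measurable (F i)) -> trivIset setT F ->
  ac_mass a (\big[setU/set0]_(i < n) F i) = \sum_(i < n) ac_mass a (F i).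
Proof.
move=> a0 aM mF tF; elim: n => [|n IH].
  by rewrite !big_ord0 (ac_mass_set0 _ _ a0 aM).
rewrite !big_ord_recr/= (ac_massU _ _ _ _ a0 aM) ?IH//.
  exact: bigsetU_measurable.
apply/eqP; apply: contraT => /set0P[x []]; rewrite -bigcup_mkord.
move=> -[i /= ni xi] xn; have e : i = n by apply: tF => //; exists x.
by move: ni; rewrite e ltnn.
Qed.

(* A truncation level [K] good for the whole line is good for every [A], which
   bounds [ac_mass a] uniformly on sets of small measure. *)
Lemma ac_mass_le_leb a A K M : nonneg a -> block_bounded a M -> measurable A ->
  ac_mass a A <=
  K%:R * leb R (A `&` I01) + (ac_mass a setT - trunc_ac a K setT).
Proof.
move=> a0 aM mA; have mC := measurableC mA.
have := trunc_ac_leb _ K _ _ a0 aM mA.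
have := trunc_ac_le_ac _ K _ _ a0 aM mC.
rewrite -(setUv A) (ac_massU _ _ _ _ a0 aM mA mC) ?setICr//.
by rewrite (trunc_acU _ _ _ _ _ a0 aM mA mC) ?setICr//; lra.
Qed.

End AbsolutelyContinuousPart.

(** * Countable additivity and the Radon-Nikodym density *)

Section Density.
Variable R : realType.
Local Notation mu := (@lebesgue_measure R).
Local Notation I01 := (`[(0:R), 1[%classic : set R).
Implicit Types (a b : nat -> R) (A B : set R) (M c : R).

Lemma leb_cvg0 (G : (set R)^nat) : (forall n, measurable (G n)) ->
  nonincreasing_seq G -> \bigcap_n G n = set0 ->
  leb R (G n `&` I01) @[n --> \oo] --> 0.
Proof.
move=> mG niG G0; pose H n := G n `&` I01.
have mH n : measurable (H n) by apply: measurableI => //; exact: measurable_itv.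
have H0 : \bigcap_n H n = set0.
  by apply/seteqP; split=> // x xH; rewrite -G0 => n _; case: (xH n I).
have : mu (H n) @[n --> \oo] --> mu (\bigcap_n H n).
  apply: nonincreasing_cvg_mu => //.
  - exact: lebI01_lty.
  - by rewrite H0.
  - move=> m n mn; apply/subsetPset; apply: setSI.
    by apply/subsetPset; exact: niG.
rewrite H0 measure0 => h; exact: (fine_cvg h).
Qed.

(** By [ac_mass_le_leb]: first fix K so that truncation loses less than e / 2 of the total mass,
    then take n so large that K times the measure of [G n] is below e / 2. *)
Lemma ac_mass_cvg0 a M (G : (set R)^nat) : nonneg _ a -> block_bounded _ a M ->
  (forall n, measurable (G n)) -> nonincreasing_seq G -> \bigcap_n G n = set0 ->
  ac_mass _ a (G n) @[n --> \oo] --> 0.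
Proof.
move=> a0 aM mG niG G0; apply/cvgrPdist_lt => e e0.
have e20 : 0 < e / 2 by rewrite divr_gt0.
have /cvgrPdist_lt/(_ _ e20)[K _ /(_ _ (leqnn _)) hK] :=
  cvg_trunc_ac _ _ _ _ a0 aM measurableT.
have hl := leb_cvg0 _ mG niG G0.
have : K%:R * leb R (G n `&` I01) @[n --> \oo] --> (K%:R * 0 : R).
  by apply: cvgM => //; exact: cvg_cst.
rewrite mulr0 => /cvgrPdist_lt/(_ _ e20); apply: filterS => n.
rewrite !sub0r !normrN => hn.
rewrite ger0_norm; last exact: ac_mass_ge0 aM _.
have := ac_mass_le_leb _ _ _ K _ a0 aM (mG n).
have := ler_norm (K%:R * leb R (G n `&` I01)).
have := ler_norm (ac_mass R a setT - trunc_ac R a K setT).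
by move: hK hn => /=; lra.
Qed.

Lemma ac_mass_sigma_additive a M : nonneg _ a -> block_bounded _ a M ->
  semi_sigma_additive (fun A => (ac_mass _ a A)%:E).
Proof.
move=> a0 aM F mF tF mUF.
(* The part of the union not yet covered; finite additivity reduces the claim to the mass of [G n]
   tending to 0. *)
pose G n := \bigcup_i F i `\` \big[setU/set0]_(i < n) F i.
have mB n : measurable (\big[setU/set0]_(i < n) F i).
  exact: bigsetU_measurable.
have mG n : measurable (G n) by exact: measurableD.
have niG : nonincreasing_seq G.
  move=> m n mn; apply/subsetPset; apply: setDS.
  exact: subset_bigsetU.
have G0 : \bigcap_n G n = set0.
  apply/seteqP; split=> // x xG; have [[i _ Fi] _] := xG 0%N I.
  have [_] := xG i.+1 I; apply; rewrite -bigcup_mkord; by exists i => /=.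
have e n : \sum_(0 <= i < n) ac_mass _ a (F i) =
    ac_mass _ a (\bigcup_i F i) - ac_mass _ a (G n).
  rewrite big_mkord -(ac_mass_bigsetU _ _ _ _ _ a0 aM)//; apply/eqP.
  rewrite eq_sym subr_eq -(ac_massU _ _ _ _ _ a0 aM)//; last first.
    by rewrite /G setDE setICA setICr setI0.
  rewrite /G setDUK// -bigcup_mkord => x [i _ Fi]; by exists i.
under eq_fun do rewrite sumEFin e.
apply: cvg_EFin; first exact: nearW.
rewrite -[X in _ --> X]subr0; apply: cvgB; first exact: cvg_cst.
exact: ac_mass_cvg0 aM _ _ _.
Qed.

Lemma ac_mass_density a M : nonneg _ a -> block_bounded _ a M ->
  exists f, in_L1_01 f /\
    forall A, measurable A -> ac_mass _ a A = \int[mu]_(x in A) f x.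
Proof.
move=> a0 aM.
pose nu0 (A : set (measurableTypeR R)) : \bar R := (ac_mass _ a A)%:E.
have nu00 : nu0 set0 = 0%E by rewrite /nu0 (ac_mass_set0 _ _ _ a0 aM).
have fnu A : measurable A -> nu0 A \is a fin_num by [].
pose nu : {charge set (measurableTypeR R) -> \bar R} := HB.pack nu0
  (isCharge.Build _ _ _ nu0 nu00 fnu (ac_mass_sigma_additive _ _ a0 aM)).
(* On a null set every truncated mass is at most K times 0. *)
have numu : nu `<< mu.
  apply/null_content_dominatesP => A mA A0.
  rewrite /nu/= /nu0; congr (_%:E); apply/eqP; rewrite eq_le.
  rewrite (ac_mass_ge0 _ _ _ _ a0 aM mA) andbT.
  apply: (ac_mass_le _ _ _ _ _ a0 aM mA) => K.
  apply: le_trans (trunc_ac_leb _ _ K _ _ a0 aM mA) _.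
  suff -> : leb R (A `&` I01) = 0 by rewrite mulr0.
  rewrite /leb (_ : mu _ = 0%E)//; apply: (subset_measure0 _ _ _ A0) => //.
  by apply: measurableI => //; exact: measurable_itv.
(* The derivative is finite at every point, so [fine] changes no value. *)
have fE : EFin \o (fine \o (Radon_Nikodym nu mu)) = Radon_Nikodym nu mu.
  by apply/funext => x /=; rewrite fineK// Radon_Nikodym_fin_num.
exists (fine \o (Radon_Nikodym nu mu)); split.
  rewrite /in_L1_01 fE.
  exact: integrableS (Radon_Nikodym_integrable numu).
move=> A mA; transitivity (fine (nu A)) => //.
by rewrite (Radon_Nikodym_integral numu mA) -fE.
Qed.

End Density.

(** * The embedding by dyadic averages, and the surviving mass of its image *)

Section CellAverages.
Variable R : realType.
Local Notation mu := (@lebesgue_measure R).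
Local Notation I01 := (`[(0:R), 1[%classic : set R).
Implicit Types (f g : R -> R) (m n i j k : nat) (A : set R) (M c : R).

(** The embedding [T] of the theorem; the power of 2 is the reciprocal of the cell length. *)
Definition cell_avg f k : R :=
  2 ^+ cell_level k * \int[mu]_(x in cell R (cell_level k) (cell_pos k)) f x.

Lemma cell_avg_index f n j : (j < 2 ^ n)%N ->
  cell_avg f (cell_index n j) = 2 ^+ n * \int[mu]_(x in cell R n j) f x.
Proof. by move=> jn; rewrite /cell_avg cell_level_index// cell_pos_index. Qed.

Lemma integrable_cell f n j : in_L1_01 f -> (j < 2 ^ n)%N ->
  mu.-integrable (cell R n j) (EFin \o f).
Proof.
move=> intf jn; apply: integrable_sub01 => //; first exact: measurable_cell.
exact: cell_sub01.
Qed.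

Lemma cell_avgD f g : in_L1_01 f -> in_L1_01 g ->
  cell_avg (fun x => f x + g x) = (fun k => cell_avg f k + cell_avg g k).
Proof.
move=> intf intg; apply/funext => k; rewrite /cell_avg -mulrDr RintegralD//.
- exact: measurable_cell.
- by apply: integrable_cell => //; exact: cell_pos_lt.
- by apply: integrable_cell => //; exact: cell_pos_lt.
Qed.

Lemma cell_avgB f g : in_L1_01 f -> in_L1_01 g ->
  cell_avg (fun x => f x - g x) = (fun k => cell_avg f k - cell_avg g k).
Proof.
move=> intf intg; apply/funext => k; rewrite /cell_avg -mulrBr RintegralB//.
- exact: measurable_cell.
- by apply: integrable_cell => //; exact: cell_pos_lt.
- by apply: integrable_cell => //; exact: cell_pos_lt.
Qed.

Lemma cell_avgZ c f : in_L1_01 f ->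
  cell_avg (fun x => c * f x) = (fun k => c * cell_avg f k).
Proof.
move=> intf; apply/funext => k; rewrite /cell_avg RintegralZl 1?mulrCA//.
- exact: measurable_cell.
- by apply: integrable_cell => //; exact: cell_pos_lt.
Qed.

Lemma in_L1_01_norm f : in_L1_01 f -> in_L1_01 (fun x => `|f x|).
Proof. by move=> intf; exact: (integrable_abse intf). Qed.

Lemma L1_normE f : in_L1_01 f -> L1_norm f = \int[mu]_(x in I01) `|f x|.
Proof.
move=> intf; rewrite Rintegral_itv_bndo_bndc//.
by apply: integrable_sub01 => //; exact: in_L1_01_norm.
Qed.

Lemma Rintegral_cells01 f n : in_L1_01 f ->
  \sum_(j < 2 ^ n) \int[mu]_(x in cell R n j) f x = \int[mu]_(x in I01) f x.
Proof.
move=> intf; rewrite -[in RHS](setTI I01) -(@Rintegral_cells _ _ _ n)//.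
  by apply: eq_bigr => j _; rewrite setTI.
by rewrite setTI; exact: integrable_sub01.
Qed.

(** Boundedness of the embedding: the triangle inequality for the integral on each cell, summed over
    the level. *)
Lemma block_bounded_cell_avg f : in_L1_01 f ->
  block_bounded _ (cell_avg f) (L1_norm f).
Proof.
move=> intf n; have intnf := in_L1_01_norm _ intf.
rewrite L1_normE// -(Rintegral_cells01 _ n)// mulr_sumr.
apply: ler_sum => j _; rewrite cell_avg_index// normrM ger0_norm ?exprn_ge0//.
rewrite ler_pM2l ?exp2_gt0//; apply: le_normr_Rintegral.
  exact: measurable_cell.
exact: integrable_cell.
Qed.

Lemma Rintegral_subcells f m n i : in_L1_01 f -> (i < 2 ^ m)%N ->
  \int[mu]_(x in cell R m i) f x =
  \sum_(j < 2 ^ n) \int[mu]_(x in cell R m i `&` cell R n j) f x.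
Proof.
move=> intf im; have e : cell R m i `&` I01 = cell R m i.
  by apply/setIidPl; exact: cell_sub01.
rewrite Rintegral_cells ?e//; first exact: measurable_cell.
exact: integrable_cell.
Qed.

Lemma leb_cell n j : leb R (cell R n j) = (2 ^+ n)^-1.
Proof. by rewrite /leb lebesgue_measure_cell. Qed.

Lemma in_L1_01_min f c : (forall x, 0 <= f x) -> 0 <= c -> in_L1_01 f ->
  in_L1_01 (fun x => Num.min (f x) c).
Proof.
move=> f0 c0 intf; apply: (@le_integrable _ _ _ mu _ _ _ (EFin \o f)) => //.
  have /measurable_EFinP mf := measurable_int _ intf.
  by apply/measurable_EFinP; apply: measurable_minr => //.
move=> x _ /=; rewrite lee_fin !ger0_norm ?f0//; last by rewrite le_min f0.
by rewrite ge_min lexx.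
Qed.

(** A cell of level n is either disjoint from [cell m i] or inside it; in the second case
    min(average, K) times 2^-n is at most the integral of f over it. *)
Lemma trunc_mass_cell_avg_le f K m n i : (forall x, 0 <= f x) -> in_L1_01 f ->
  (m <= n)%N -> (i < 2 ^ m)%N ->
  trunc_mass _ (cell_avg f) K n (cell R m i) <= \int[mu]_(x in cell R m i) f x.
Proof.
move=> f0 intf mn im; rewrite (Rintegral_subcells _ _ n)//.
apply: ler_sum => j _; rewrite cell_avg_index//.
have [h|h] := cell_nested R _ _ i j mn.
  rewrite (setIidr h) leb_cell ler_pdivrMr ?exp2_gt0// ge_min mulrC.
  by rewrite lexx.
by rewrite h Rintegral_set0 /leb measure0 mulr0.
Qed.

(* Jensen's inequality for the concave function [min _ K] on each cell. *)
Lemma trunc_mass_cell_avg_ge f K m n i : (forall x, 0 <= f x) -> 0 <= K ->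
  in_L1_01 f -> (m <= n)%N -> (i < 2 ^ m)%N ->
  \int[mu]_(x in cell R m i) Num.min (f x) K <=
  trunc_mass _ (cell_avg f) K n (cell R m i).
Proof.
move=> f0 K0 intf mn im; have intm := in_L1_01_min _ _ f0 K0 intf.
rewrite (Rintegral_subcells _ _ n)//.
apply: ler_sum => j _; rewrite cell_avg_index//.
have [h|h] := cell_nested R _ _ i j mn; last first.
  by rewrite h Rintegral_set0 /leb measure0 mulr0.
have mc := measurable_cell R n j.
have cy : (mu (cell R n j) < +oo)%E by rewrite lebesgue_measure_cell ltry.
rewrite (setIidr h) leb_cell ler_pdivlMr ?exp2_gt0// le_min mulrC.
rewrite ler_pM2l ?exp2_gt0//; apply/andP; split.
  apply: le_Rintegral => //; try exact: integrable_cell.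
  by move=> x _; rewrite ge_min lexx.
rewrite -ler_pdivlMl ?exp2_gt0// mulrC -(leb_cell n j).
have <- : \int[mu]_(x in cell R n j) K = K * leb R (cell R n j).
  by rewrite Rintegral_cst.
apply: le_Rintegral => //; first exact: integrable_cell.
  by apply: measurable_bounded_integrable => //; exact: bounded_cst.
by move=> x _; rewrite ge_min lexx orbT.
Qed.

Lemma cvg_Rintegral_min f A : (forall x, 0 <= f x) -> measurable A ->
  mu.-integrable A (EFin \o f) ->
  \int[mu]_(x in A) Num.min (f x) K%:R @[K --> \oo] --> \int[mu]_(x in A) f x.
Proof.
move=> f0 mA intf.
have /measurable_EFinP mf := measurable_int _ intf.
have : (\int[mu]_(x in A) (Num.min (f x) K%:R)%:E)%E @[K --> \oo] -->
    (\int[mu]_(x in A) (f x)%:E)%E.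
  rewrite [X in _ --> X](_ : _ = (\int[mu]_(x in A)
      limn (fun K : nat => (Num.min (f x) K%:R)%:E))%E).
    apply: cvg_monotone_convergence => //.
    - by move=> K; apply/measurable_EFinP; exact: measurable_minr.
    - by move=> K x _; rewrite lee_fin le_min f0 ler0n.
    - move=> x _ K L KL; rewrite lee_fin le_min ge_min lexx/= ge_min ler_nat KL.
      by rewrite orbT.
  apply: eq_integral => x _; apply/esym/cvg_lim => //; apply: cvg_near_cst.
  (* At each point the truncations are stationary once K exceeds [f x]. *)
  exists (Num.truncn (f x)).+1 => // K /= hK; congr (_%:E); apply/min_idPl.
  by rewrite ltW// (lt_le_trans (truncnS_gt _))// ler_nat.
rewrite -[X in _ --> X]fineK => [h2|]; last exact: integrable_fin_num.
exact: (fine_cvg h2).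
Qed.

Lemma nonneg_cell_avg f : (forall x, 0 <= f x) -> nonneg _ (cell_avg f).
Proof.
by move=> f0 k; rewrite mulr_ge0 ?exprn_ge0//; apply: Rintegral_ge0.
Qed.

(** Cells suffice here, since [ces_proj] evaluates masses on nothing else. *)
Lemma ac_mass_cell_avg f m i : (forall x, 0 <= f x) -> in_L1_01 f ->
  (i < 2 ^ m)%N ->
  ac_mass _ (cell_avg f) (cell R m i) = \int[mu]_(x in cell R m i) f x.
Proof.
move=> f0 intf im; have mc := measurable_cell R m i.
have a0 := nonneg_cell_avg _ f0; have aM := block_bounded_cell_avg _ intf.
apply/eqP; rewrite eq_le; apply/andP; split.
  apply: (ac_mass_le _ _ _ _ _ a0 aM mc) => K.
  rewrite -(ulim_cst R (\int[mu]_(x in cell R m i) f x)).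
  apply: (@ler_ulim _ _ _ (L1_norm f) `|\int[mu]_(x in cell R m i) f x| m) => n.
  - exact: normr_trunc_mass_le.
  - by [].
  - by move=> mn; exact: trunc_mass_cell_avg_le.
(* The Jensen bound at each level K gives the integral of f in the limit, by monotone
   convergence. *)
have h := cvg_Rintegral_min _ _ f0 mc (integrable_cell _ _ _ intf im).
rewrite -(cvg_lim _ h)//; apply: limr_le; first exact: (cvgP _ h).
apply: nearW => K; apply: le_trans (trunc_ac_le_ac _ _ K _ _ a0 aM mc).
rewrite -(ulim_cst R (\int[mu]_(x in cell R m i) Num.min (f x) K%:R)).
apply: (@ler_ulim _ _ _ `|\int[mu]_(x in cell R m i) Num.min (f x) K%:R|
  (L1_norm f) m) => n.
- by [].
- exact: normr_trunc_mass_le.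
- by move=> mn; exact: trunc_mass_cell_avg_ge.
Qed.

End CellAverages.

(** * The lower bound for the embedding, by differentiation and Fatou's lemma *)

Section LowerBound.
Variable R : realType.
Local Notation mu := (@lebesgue_measure R).
Local Notation I01 := (`[(0:R), 1[%classic : set R).
Implicit Types (f : R -> R) (n i j k : nat) (M x : R).

(** The use of [floor] makes sense of it at every real x without choosing a cell; on [[0, 1[] it is
    a cell. *)
Definition dyadic_nbhd x n : set R :=
  `[(Num.floor (x * 2 ^+ n))%:~R / 2 ^+ n,
    ((Num.floor (x * 2 ^+ n))%:~R + 1) / 2 ^+ n[.

Lemma dyadic_nbhd_mem x n : dyadic_nbhd x n x.
Proof.
rewrite /dyadic_nbhd/= in_itv/= ler_pdivrMr ?exp2_gt0// ltr_pdivlMr ?exp2_gt0//.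
by have := floor_itv (x * 2 ^+ n); rewrite intrD.
Qed.

Lemma dyadic_nbhd_cell x n : I01 x ->
  exists2 j, (j < 2 ^ n)%N & dyadic_nbhd x n = cell R n j.
Proof.
rewrite -(bigcup_cells01 _ n) -bigcup_mkord => -[j /= jn xj]; exists j => //.
rewrite /dyadic_nbhd /cell (_ : Num.floor _ = j%:Z) ?natr1//.
apply: floor_def; move: xj => /cellE; by rewrite -[j.+1%:R]natr1 intrD.
Qed.

Lemma dyadic_nbhd_nicely_shrinking x : nicely_shrinking x (dyadic_nbhd x).
Proof.
split=> [n|]; first exact: measurable_itv.
have r0 n : 0 < (2^-1 : R) ^+ n by rewrite exprn_gt0// invr_gt0.
pose r n : {posnum R} := PosNum (r0 n).
(* The ball of radius 2^-n has length 2 * 2^-n, twice that of the dyadic interval. *)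
exists (2, r); split => //=.
- apply: cvg_expr; rewrite ger0_norm//; lra.
- move=> n y; have := dyadic_nbhd_mem x n.
  rewrite /dyadic_nbhd/= !in_itv/= mulrDl mul1r.
  set z := _ / _; move=> /andP[x1 x2] /andP[y1 y2].
  by rewrite /ball/= exprVn ltr_distlC; lra.
- move=> n; rewrite lebesgue_measure_ball ?exprn_ge0//.
  rewrite /dyadic_nbhd lebesgue_measure_itv/= lte_fin.
  rewrite ltr_pM2r ?invr_gt0 ?exp2_gt0//.
  rewrite ltrDl ltr01 -EFinB -EFinM lee_fin exprVn mulrDl mul1r; lra.
Qed.

Lemma cell_avg_dyadic_nbhd f x : in_L1_01 f -> I01 x ->
  lebesgue_pt (f \_ I01) x ->
  (\sum_(j < 2 ^ n) `|cell_avg _ f (cell_index n j)|%:E *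
     (\1_(cell R n j) x)%:E)%E @[n --> \oo] --> (`|f x|)%:E.
Proof.
move=> intf x01 fx.
have int01 : mu.-integrable I01 (EFin \o f) by exact: integrable_sub01.
have locf : locally_integrable setT (f \_ I01).
  by apply: integrable_locally_restrict => //; exact: measurable_itv.
have := nice_lebesgue_differentiation dyadic_nbhd_nicely_shrinking locf fx.
rewrite patchE mem_set// => /cvg_abse /=.
apply: cvg_trans; apply: near_eq_cvg; apply: nearW => n.
(* Only the cell containing x contributes to the sum, and its term is the average over
   [dyadic_nbhd x n]. *)
have [i ni e] := dyadic_nbhd_cell _ n x01.
have xi : cell R n i x by rewrite -e; exact: dyadic_nbhd_mem.
rewrite e (bigD1 (Ordinal ni))//= big1 ?adde0; last first.
  move=> j /eqP ji; rewrite indicE memNset ?mule0// => xj.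
  by apply: ji; apply/val_inj => /=; exact: cell_inj xj xi.
rewrite indicE mem_set// mule1 cell_avg_index// lebesgue_measure_cell.
rewrite inver gt_eqF ?invr_gt0 ?exp2_gt0// invrK.
have -> : (\int[mu]_(y in cell R n i) ((f \_ I01) y)%:E =
    (\int[mu]_(y in cell R n i) f y)%:E)%E.
  rewrite fineK; last first.
    apply: integrable_fin_num; first exact: measurable_cell.
    exact: integrable_cell.
  apply: eq_integral => y; rewrite inE => yi; rewrite patchE mem_set//.
  exact: cell_sub01 yi.
by [].
Qed.

Lemma L1_norm_le_block_bound f M : in_L1_01 f ->
  block_bounded _ (cell_avg _ f) M -> L1_norm f <= M.
Proof.
move=> intf fM.
(* The modulus of the step function of block n; its integral is the normalised block sum, at most
   M. *)
pose G n x := (\sum_(j < 2 ^ n) `|cell_avg _ f (cell_index n j)|%:E *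
     (\1_(cell R n j) x)%:E)%E.
have m01 : measurable I01 by exact: measurable_itv.
have mterm n j : measurable_fun I01 (fun x =>
    `|cell_avg _ f (cell_index n j)|%:E * (\1_(cell R n j) x)%:E)%E.
  apply: emeasurable_funM => //; apply/measurable_EFinP.
  by apply: measurable_funTS; apply: measurable_indic; exact: measurable_cell.
have mG n : measurable_fun I01 (G n) by exact: emeasurable_sum.
have G0 n x : I01 x -> (0 <= G n x)%E.
  by move=> _; apply: sume_ge0 => j _; rewrite mule_ge0// lee_fin.
have intG n : (\int[mu]_(x in I01) G n x <= M%:E)%E.
  have t0 j x : I01 x ->
      (0 <= `|cell_avg _ f (cell_index n j)|%:E * (\1_(cell R n j) x)%:E)%E.
    by move=> _; rewrite mule_ge0// lee_fin.
  rewrite (ge0_integral_sum mu m01 (fun j : 'I_(2 ^ n) => mterm n j)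
    (fun j : 'I_(2 ^ n) => t0 j)).
  rewrite (eq_bigr (fun j : 'I_(2 ^ n) =>
      (`|cell_avg _ f (cell_index n j)| / 2 ^+ n)%:E)).
    rewrite sumEFin lee_fin -mulr_suml ler_pdivrMr ?exp2_gt0// mulrC.
    exact: fM.
  move=> j _; have mc := measurable_cell R n j.
  rewrite ge0_integralZl//.
    rewrite integral_indic// setIidl; last exact: cell_sub01.
    by rewrite EFinM; congr (_ * _)%E; exact: lebesgue_measure_cell.
  apply/measurable_EFinP.
  by apply: measurable_funTS; exact: measurable_indic.
have int01 : mu.-integrable I01 (EFin \o f) by exact: integrable_sub01.
have /measurable_EFinP mf := measurable_int _ int01.
have fnum : (\int[mu]_(x in I01) `|f x|%:E)%E \is a fin_num.
  apply: (@integrable_fin_num _ _ _ mu) => //; exact: (integrable_abse int01).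
rewrite L1_normE// -lee_fin /Rintegral fineK//.
(* [G n] tends to |f| at every Lebesgue point, so the lower limit replaces |f| almost everywhere and
   Fatou's lemma applies. *)
have -> : (\int[mu]_(x in I01) `|f x|%:E =
    \int[mu]_(x in I01) limn_einf (G ^~ x))%E.
  apply: ae_eq_integral => //.
  - by apply/measurable_EFinP; exact: measurableT_comp.
  - apply: measurableT_comp => //.
    apply: (@measurable_fun_limn_esup _ _ _ _ (fun n x => - G n x)%E) => n.
    exact: measurableT_comp.
  - have [N [mN N0 subN]] :=
      lebesgue_differentiation (integrable_locally_restrict m01 int01).
    exists N; split => // x xN; apply: subN => fx; apply: xN => x01.
    by have [->] := cvg_limn_einf_sup (cell_avg_dyadic_nbhd _ _ intf x01 fx).
apply: (le_trans (fatou mu m01 mG G0)).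
rewrite limn_einf_lim; apply: lime_le; first exact: is_cvg_einfs.
apply: nearW => n; apply: le_trans (intG n).
by apply: ereal_inf_lbound; exists n => /=.
Qed.

End LowerBound.

(** * Extension to signed sequences and the projection *)

Section Projection.
Variable R : realType.
Local Notation mu := (@lebesgue_measure R).
Local Notation I01 := (`[(0:R), 1[%classic : set R).
Implicit Types (a b p q : nat -> R) (f : R -> R) (A : set R) (M N c : R).

Definition pos_part a k : R := Num.max (a k) 0.
Definition neg_part a k : R := Num.max (- a k) 0.

Lemma nonneg_pos_part a : nonneg _ (pos_part a).
Proof. by move=> k; rewrite le_max lexx orbT. Qed.

Lemma nonneg_neg_part a : nonneg _ (neg_part a).
Proof. by move=> k; rewrite le_max lexx orbT. Qed.

Lemma pos_partB a k : a k = pos_part a k - neg_part a k.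
Proof.
by rewrite /pos_part /neg_part !maxEle; do 2 case: ifPn; rewrite -?ltNge; lra.
Qed.

Lemma block_bounded_le a b M : (forall k, `|a k| <= `|b k|) ->
  block_bounded _ b M -> block_bounded _ a M.
Proof.
by move=> ab bM n; apply: le_trans (bM n); apply: ler_sum => j _; exact: ab.
Qed.

Lemma block_bounded_pos_part a M :
  block_bounded _ a M -> block_bounded _ (pos_part a) M.
Proof.
apply: block_bounded_le => k; rewrite ger0_norm ?nonneg_pos_part//.
by rewrite ge_max ler_norm normr_ge0.
Qed.

Lemma block_bounded_neg_part a M :
  block_bounded _ a M -> block_bounded _ (neg_part a) M.
Proof.
apply: block_bounded_le => k; rewrite ger0_norm ?nonneg_neg_part//.
by rewrite ge_max -normrN ler_norm normr_ge0.
Qed.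

Definition signed_ac a A : R :=
  ac_mass _ (pos_part a) A - ac_mass _ (neg_part a) A.

(** Independence of the decomposition: from a^+ + q = a^- + p, additivity of [ac_mass] gives equal
    differences. Linearity follows by choosing convenient p and q. *)
Lemma signed_acB p q A M N : nonneg _ p -> nonneg _ q ->
  block_bounded _ p M -> block_bounded _ q N -> measurable A ->
  signed_ac (fun k => p k - q k) A = ac_mass _ p A - ac_mass _ q A.
Proof.
move=> p0 q0 pM qN mA; set a := fun k => p k - q k.
have aMN : block_bounded _ a (M + N).
  apply: block_bounded_le (block_boundedD _ _ _ _ _ pM qN) => k.
  rewrite [leRHS]ger0_norm ?addr_ge0// (le_trans (ler_normB _ _))//.
  by rewrite !ger0_norm.
have a1 := nonneg_pos_part a; have a2 := nonneg_neg_part a.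
have h1 := block_bounded_pos_part _ _ aMN.
have h2 := block_bounded_neg_part _ _ aMN.
have : ac_mass _ (fun k => pos_part a k + q k) A =
    ac_mass _ (fun k => neg_part a k + p k) A.
  apply: (congr1 (fun u => ac_mass R u A)); apply/funext => k.
  have := pos_partB a k.
  by rewrite {1}/a; lra.
rewrite (ac_massD _ _ _ _ _ _ a1 q0 h1 qN)//.
rewrite (ac_massD _ _ _ _ _ _ a2 p0 h2 pM)//.
by rewrite /signed_ac; lra.
Qed.

Lemma signed_acD a b A M N : block_bounded _ a M -> block_bounded _ b N ->
  measurable A ->
  signed_ac (fun k => a k + b k) A = signed_ac a A + signed_ac b A.
Proof.
move=> aM bN mA.
have a1 := nonneg_pos_part a; have a2 := nonneg_neg_part a.
have b1 := nonneg_pos_part b; have b2 := nonneg_neg_part b.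
have ha1 := block_bounded_pos_part _ _ aM.
have ha2 := block_bounded_neg_part _ _ aM.
have hb1 := block_bounded_pos_part _ _ bN.
have hb2 := block_bounded_neg_part _ _ bN.
rewrite (_ : (fun k => _) = fun k => (pos_part a k + pos_part b k) -
    (neg_part a k + neg_part b k)); last first.
  by apply/funext => k; rewrite {1}(pos_partB a k) {1}(pos_partB b k); lra.
rewrite (@signed_acB _ _ _ (M + N) (M + N))//.
- rewrite (ac_massD _ _ _ _ _ _ a1 b1 ha1 hb1)//.
  rewrite (ac_massD _ _ _ _ _ _ a2 b2 ha2 hb2)//.
  by rewrite /signed_ac; lra.
- by move=> k; rewrite addr_ge0.
- by move=> k; rewrite addr_ge0.
- exact: block_boundedD.
- exact: block_boundedD.
Qed.

Lemma signed_acZ a c A M : block_bounded _ a M -> measurable A ->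
  signed_ac (fun k => c * a k) A = c * signed_ac a A.
Proof.
move=> aM mA.
have a1 := nonneg_pos_part a; have a2 := nonneg_neg_part a.
have h1 := block_bounded_pos_part _ _ aM.
have h2 := block_bounded_neg_part _ _ aM.
have [c0|c0|<-] := ltrgtP 0 c.
- rewrite (_ : (fun k => _) = fun k => c * pos_part a k - c * neg_part a k).
    rewrite (signed_acB _ _ _ _ _ _ _ (block_boundedZ _ _ c _ h1)
      (block_boundedZ _ _ c _ h2))//.
    + rewrite (ac_massZ _ _ _ _ _ a1 h1)// (ac_massZ _ _ _ _ _ a2 h2)//.
      by rewrite -mulrBr.
    + by move=> k; rewrite mulr_ge0// ltW.
    + by move=> k; rewrite mulr_ge0// ltW.
  by apply/funext => k; rewrite -mulrBr -pos_partB.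
(* A negative factor exchanges the positive and negative parts. *)
- have nc0 : 0 < - c by rewrite oppr_gt0.
  rewrite (_ : (fun k => _) =
      fun k => (- c) * neg_part a k - (- c) * pos_part a k).
    rewrite (signed_acB _ _ _ _ _ _ _ (block_boundedZ _ _ (- c) _ h2)
      (block_boundedZ _ _ (- c) _ h1))//.
    + rewrite (ac_massZ _ _ _ _ _ a1 h1)// (ac_massZ _ _ _ _ _ a2 h2)//.
      by rewrite /signed_ac; lra.
    + by move=> k; rewrite mulr_ge0// ltW.
    + by move=> k; rewrite mulr_ge0// ltW.
  by apply/funext => k; rewrite {1}(pos_partB a k); lra.
(* [ac_massZ] covers only c > 0, so the zero sequence is written as p - p. *)
- rewrite (_ : (fun k => _) = fun k => pos_part a k - pos_part a k).
    by rewrite (signed_acB _ _ _ _ _ a1 a1 h1 h1)// subrr mul0r.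
  by apply/funext => k; rewrite mul0r subrr.
Qed.

(** The dyadic averages of the density of [signed_ac a], expressed by masses so that no density has
    to be chosen. *)
Definition ces_proj a k : R :=
  2 ^+ cell_level k * signed_ac a (cell R (cell_level k) (cell_pos k)).

Lemma ac_mass_cells a n M : nonneg _ a -> block_bounded _ a M ->
  \sum_(j < 2 ^ n) ac_mass _ a (cell R n j) <= M.
Proof.
move=> a0 aM; rewrite -(ac_mass_bigsetU _ _ _ (cell R n) _ a0 aM).
- rewrite bigcup_cells01; apply: ac_mass_le_bound => //; exact: measurable_itv.
- by move=> j; exact: measurable_cell.
- by move=> i j _ _ [x [xi xj]]; exact: cell_inj xi xj.
Qed.

(** The positive and the negative part each have total mass at most M. *)
Lemma block_bounded_ces_proj a M : block_bounded _ a M ->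
  block_bounded _ (ces_proj a) (M + M).
Proof.
move=> aM n.
have a1 := nonneg_pos_part a; have a2 := nonneg_neg_part a.
have h1 := block_bounded_pos_part _ _ aM.
have h2 := block_bounded_neg_part _ _ aM.
apply: (@le_trans _ _ (2 ^+ n *
  (\sum_(j < 2 ^ n) ac_mass _ (pos_part a) (cell R n j) +
   \sum_(j < 2 ^ n) ac_mass _ (neg_part a) (cell R n j)))); last first.
  by rewrite ler_pM2l ?exp2_gt0// lerD// ac_mass_cells.
rewrite -big_split/= mulr_sumr; apply: ler_sum => j _.
have mc := measurable_cell R n j.
rewrite /ces_proj cell_level_index// cell_pos_index//.
rewrite normrM ger0_norm ?exprn_ge0// ler_pM2l ?exp2_gt0//.
rewrite (le_trans (ler_normB _ _))// !ger0_norm//.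
  exact: ac_mass_ge0 h2 _.
exact: ac_mass_ge0 h1 _.
Qed.

Lemma ces_proj_range a M : block_bounded _ a M ->
  exists f, in_L1_01 f /\ ces_proj a = cell_avg _ f.
Proof.
move=> aM.
have [f [intf fE]] := ac_mass_density _ _ _ (nonneg_pos_part a)
  (block_bounded_pos_part _ _ aM).
have [g [intg gE]] := ac_mass_density _ _ _ (nonneg_neg_part a)
  (block_bounded_neg_part _ _ aM).
exists (fun x => f x - g x); split.
  rewrite /in_L1_01 (_ : EFin \o _ = (EFin \o f) \- (EFin \o g))%E//.
  exact: integrableB.
rewrite cell_avgB//; apply/funext => k; rewrite /ces_proj /signed_ac /cell_avg.
by rewrite fE ?gE -?mulrBr//; exact: measurable_cell.
Qed.

(** The averages of f^+ and f^- need not be the positive and negative parts of the averages of f;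
    [signed_acB] accepts them all the same. *)
Lemma ces_proj_cell_avg f : in_L1_01 f ->
  ces_proj (cell_avg _ f) = cell_avg _ f.
Proof.
move=> intf.
have intp : in_L1_01 (fun x => Num.max (f x) 0).
  by apply: (@integrable_funrpos _ _ _ mu _ f).
have intn : in_L1_01 (fun x => Num.max (- f x) 0).
  by apply: (@integrable_funrneg _ _ _ mu _ f).
have p0 x : 0 <= Num.max (f x) 0 by rewrite le_max lexx orbT.
have n0 x : 0 <= Num.max (- f x) 0 by rewrite le_max lexx orbT.
have fE : f = fun x => Num.max (f x) 0 - Num.max (- f x) 0.
  apply/funext => x.
  by rewrite !maxEle; do 2 case: ifPn; rewrite -?ltNge; lra.
apply/funext => k; rewrite fE cell_avgB// /ces_proj.
have mc := measurable_cell R (cell_level k) (cell_pos k).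
rewrite (signed_acB _ _ _ _ _ _ _ (block_bounded_cell_avg _ _ intp)
  (block_bounded_cell_avg _ _ intn))//; try exact: nonneg_cell_avg.
by rewrite !ac_mass_cell_avg ?cell_pos_lt// mulrBr.
Qed.

End Projection.

Theorem theorem3 (R : realType) :
  exists (T : (R -> R) -> nat -> R) (P : (nat -> R) -> nat -> R),
    (* T is linear on L_1[0,1] *)
    (forall f g, in_L1_01 f -> in_L1_01 g ->
       T (fun x => f x + g x) = (fun n => T f n + T g n)) /\
    (forall (c : R) f, in_L1_01 f ->
       T (fun x => c * f x) = (fun n => c * T f n)) /\
    (* T maps into ces_infinity *)
    (forall f, in_L1_01 f -> in_ces_inf (T f)) /\
    (* T is an isomorphism onto its range *)
    (exists c C : R, 0 < c /\
       forall f, in_L1_01 f ->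
         c * L1_norm f <= ces_norm (T f) /\ ces_norm (T f) <= C * L1_norm f) /\
    (* P is a bounded linear operator on ces_infinity *)
    (forall a b, in_ces_inf a -> in_ces_inf b ->
       P (fun n => a n + b n) = (fun n => P a n + P b n)) /\
    (forall (c : R) a, in_ces_inf a ->
       P (fun n => c * a n) = (fun n => c * P a n)) /\
    (forall a, in_ces_inf a -> in_ces_inf (P a)) /\
    (exists C : R, forall a, in_ces_inf a -> ces_norm (P a) <= C * ces_norm a) /\
    (* P is a projection *)
    (forall a, in_ces_inf a -> P (P a) = P a) /\
    (* the range of P is exactly the range of T *)
    (forall a, in_ces_inf a -> exists f, in_L1_01 f /\ P a = T f) /\
    (forall f, in_L1_01 f -> P (T f) = T f).
Proof.
have Tces f : in_L1_01 f -> in_ces_inf (cell_avg R f).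
  move=> intf; apply/in_ces_infP; exists (L1_norm f).
  exact: block_bounded_cell_avg.
have normB a : in_ces_inf a -> block_bounded R a (2 * ces_norm a).
  by move=> ha n; apply: block_sum_le => m; exact: ces_avg_le_norm.
exists (cell_avg R), (ces_proj R); do ![split].
- by move=> f g; exact: cell_avgD.
- by move=> c f; exact: cell_avgZ.
- exact: Tces.
(* Each passage between the Cesàro norm and the block norm costs a factor 2. *)
- exists (2^-1), 2; split=> [|f intf]; first by rewrite invr_gt0.
  split.
    rewrite ler_pdivrMl//; apply: L1_norm_le_block_bound => //.
    exact/normB/Tces.
  apply: ces_norm_le => m; apply: ces_avg_le.
  exact: block_bounded_cell_avg.
- move=> a b /in_ces_infP[M aM] /in_ces_infP[N bN]; apply/funext => k.
  rewrite /ces_proj (signed_acD _ _ _ _ _ _ aM bN) ?mulrDr//.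
  exact: measurable_cell.
- move=> c a /in_ces_infP[M aM]; apply/funext => k.
  rewrite /ces_proj (signed_acZ _ _ _ _ _ aM) 1?mulrCA//.
  exact: measurable_cell.
- move=> a /in_ces_infP[M aM]; apply/in_ces_infP; exists (M + M).
  exact: block_bounded_ces_proj.
(* A factor 2 to reach block bounds, 2 for the two signs, and 2 to return. *)
- exists 8 => a /normB/block_bounded_ces_proj h; apply: ces_norm_le => m.
  by apply: (le_trans (ces_avg_le _ _ _ _ h)); lra.
(* As [P a] is [T f] for some f, idempotence reduces to [P] fixing the range of [T]. *)
- move=> a /in_ces_infP[M /ces_proj_range[f [intf ->]]].
  exact: ces_proj_cell_avg.
- by move=> a /in_ces_infP[M /ces_proj_range].
- by move=> f; exact: ces_proj_cell_avg.
Qed.
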